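(* Let $d$ be a constant and $\epsilon\in(0,1)$. Given any terminal set $T\subseteq X$ in an $n$-point metric space $(X,\delta)$ of correlation dimension $d$, a subset $(1+\epsilon)$-spanner for $T$ with lightness $\tilde{O}\!\left(\epsilon^{-(d/2+3)}\sqrt{n}\right)$ can be constructed in polynomial time.
   Context: For $x\in X$, $r>0$, $Y\subseteq X$, let $B_Y(x,r)=\{y\in Y:\delta(x,y)\le r\}$. A set $N\subseteq Y$ is an $r$-net of $Y$ if every $y\in Y$ has some $p\in N$ with $\delta(p,y)\le r$ and distinct points of $N$ are at distance $>r$; $N$ is a net of $X$ if it is an $r$-net of $X$ for some $r>0$. The correlation dimension of $(X,\delta)$ is the smallest $d$ such that $\sum_{x\in N}|B_N(x,2r)|\le 2^d\sum_{x\in N}|B_N(x,r)|$ for every net $N$ of $X$ and every $r>0$. The metric is viewed as the complete graph on $X$ with edge weights $\delta$. A subset $(1+\epsilon)$-spanner for $T$ is a subgraph $S$ of this complete graph with $d_S(x,y)\le(1+\epsilon)\delta(x,y)$ for all $x,y\in T$; its lightness is its total weight divided by the weight of a minimum Steiner tree spanning $T$ in this complete graph. $\tilde{O}$ suppresses a $\log(1/\epsilon)$ factor. *)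

(* Defs.v *)
From HB Require Import structures.
From mathcomp Require Import all_boot all_order all_algebra.
From mathcomp Require Import all_classical all_reals all_analysis.
Set Implicit Arguments.
Unset Strict Implicit.
Unset Printing Implicit Defensive.
Import Order.TTheory GRing.Theory Num.Theory.
Local Open Scope ring_scope.

Definition is_metric (R : realType) (X : Type) (delta : X -> X -> R) : Prop :=
  [/\ forall x y, 0 <= delta x y,
      forall x y, delta x y = 0 <-> x = y,
      forall x y, delta x y = delta y x &
      forall x y z, delta x z <= delta x y + delta y z].

Definition ball_in (R : realType) (X : finType) (delta : X -> X -> R)
    (Y : {set X}) (x : X) (r : R) : {set X} :=
  [set y in Y | delta x y <= r].

Definition is_rnet (R : realType) (X : finType) (delta : X -> X -> R)
    (r : R) (Y N : {set X}) : Prop :=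
  [/\ N \subset Y,
      forall y, y \in Y -> exists2 p, p \in N & delta p y <= r &
      forall p q, p \in N -> q \in N -> p != q -> r < delta p q].

Definition is_net (R : realType) (X : finType) (delta : X -> X -> R)
    (N : {set X}) : Prop :=
  exists2 r : R, 0 < r & is_rnet delta r [set: X] N.

Definition corr_dim_bound (R : realType) (X : finType) (delta : X -> X -> R)
    (d : R) : Prop :=
  forall (N : {set X}) (r : R), is_net delta N -> 0 < r ->
    (\sum_(x in N) #|ball_in delta N x (2 * r)%R|)%N%:R
      <= 2 `^ d * (\sum_(x in N) #|ball_in delta N x r|)%N%:R.

Definition is_corr_dim (R : realType) (X : finType) (delta : X -> X -> R)
    (d : R) : Prop :=
  corr_dim_bound delta d /\ forall d', corr_dim_bound delta d' -> d <= d'.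

(* A subgraph of the complete graph on X is given by its adjacency relation. *)
Definition is_graph (X : finType) (S : rel X) : Prop :=
  symmetric S /\ irreflexive S.

(* Every edge occurs twice in the double sum, once per orientation. *)
Definition weight (R : realType) (X : finType) (delta : X -> X -> R)
    (S : rel X) : R :=
  (\sum_(x : X) \sum_(y : X | S x y) delta x y) / 2.

(* Total length of the walk x :: p. *)
Definition walk_weight (R : realType) (X : finType) (delta : X -> X -> R)
    (x : X) (p : seq X) : R :=
  \sum_(e <- zip (x :: p) p) delta e.1 e.2.

(* Shortest-path distance in S; it is +oo between distinct components. *)
Definition graph_dist (R : realType) (X : finType) (delta : X -> X -> R)
    (S : rel X) (x y : X) : \bar R :=
  ereal_inf [set w | exists p : seq X,
    [/\ path S x p, last x p = y & w = (walk_weight delta x p)%:E]]%classic.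

Definition is_subset_spanner (R : realType) (X : finType)
    (delta : X -> X -> R) (T : {set X}) (eps : R) (S : rel X) : Prop :=
  is_graph S /\
  forall x y, x \in T -> y \in T ->
    (graph_dist delta S x y <= ((1 + eps) * delta x y)%:E)%E.

(* (V, M) is a tree: all edges of M join vertices of V, and it is connected
   and acyclic. *)
Definition is_tree (X : finType) (V : {set X}) (M : rel X) : Prop :=
  [/\ is_graph M,
      forall x y, M x y -> (x \in V) && (y \in V),
      forall x y, x \in V -> y \in V -> connect M x y &
      forall c : seq X, ucycle M c -> (size c <= 2)%N].

Definition is_steiner_tree (X : finType) (T V : {set X}) (M : rel X) : Prop :=
  is_tree V M /\ T \subset V.

Definition is_min_steiner_tree (R : realType) (X : finType)
    (delta : X -> X -> R) (T V : {set X}) (M : rel X) : Prop :=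
  is_steiner_tree T V M /\
  forall V' M', is_steiner_tree T V' M' -> weight delta M <= weight delta M'.

(* "The lightness of S is at most L", in multiplied-out form: if #|T| <= 1 the
   minimum Steiner tree has weight 0, and then S must have weight 0 too. *)
Definition lightness_le (R : realType) (X : finType)
    (delta : X -> X -> R) (T : {set X}) (S : rel X) (L : R) : Prop :=
  exists (V : {set X}) (M : rel X),
    is_min_steiner_tree delta T V M /\ weight delta S <= L * weight delta M.

(* A real RAM, presented as a small structured imperative language.  The memory
   consists of finitely many (per program) two-dimensional arrays of naturals
   and of reals; a[i, j] is the cell (i, j) of array number a.
   - Naturals support only +, truncated - and <=, so that after t steps they
     have O(t) bits: unit-cost multiplication would be unrealistically strong.
   - Reals support exact field operations and comparison at unit cost,
     with no rounding to integers and no constants but 0 and 1. *)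
Inductive nexp : Type :=
| NConst of nat
| NCell of nat & nexp & nexp
| NAdd of nexp & nexp
| NSub of nexp & nexp.

Inductive rexp : Type :=
| RZero
| ROne
| RCell of nat & nexp & nexp
| RAdd of rexp & rexp
| RSub of rexp & rexp
| RMul of rexp & rexp
| RDiv of rexp & rexp.

Inductive bexp : Type :=
| BNLe of nexp & nexp
| BRLe of rexp & rexp
| BNot of bexp
| BAnd of bexp & bexp.

Inductive cmd : Type :=
| CSkip
| CNSet of nat & nexp & nexp & nexp (* CNSet a i j e is a[i, j] := e *)
| CRSet of nat & nexp & nexp & rexp
| CSeq of cmd & cmd
| CIf of bexp & cmd & cmd
| CWhile of bexp & cmd.

Record state (R : Type) : Type := State {
  nmem : nat -> nat -> nat -> nat;
  rmem : nat -> nat -> nat -> R }.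

Definition upd (V : Type) (m : nat -> nat -> nat -> V) (a i j : nat) (v : V) :
    nat -> nat -> nat -> V :=
  fun a' i' j' => if [&& a' == a, i' == i & j' == j] then v else m a' i' j'.

Fixpoint neval (R : realType) (s : state R) (e : nexp) : nat :=
  match e with
  | NConst k => k
  | NCell a i j => nmem s a (neval s i) (neval s j)
  | NAdd e1 e2 => (neval s e1 + neval s e2)%N
  | NSub e1 e2 => (neval s e1 - neval s e2)%N
  end.

Fixpoint reval (R : realType) (s : state R) (e : rexp) : R :=
  match e with
  | RZero => 0
  | ROne => 1
  | RCell a i j => rmem s a (neval s i) (neval s j)
  | RAdd e1 e2 => reval s e1 + reval s e2
  | RSub e1 e2 => reval s e1 - reval s e2
  | RMul e1 e2 => reval s e1 * reval s e2
  | RDiv e1 e2 => reval s e1 / reval s e2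
  end.

Fixpoint beval (R : realType) (s : state R) (b : bexp) : bool :=
  match b with
  | BNLe e1 e2 => (neval s e1 <= neval s e2)%N
  | BRLe e1 e2 => reval s e1 <= reval s e2
  | BNot b1 => ~~ beval s b1
  | BAnd b1 b2 => beval s b1 && beval s b2
  end.

(* exec c s t s' : run from s, the command c halts in s' after t steps.
   Assignments and tests cost one step each; the expressions occurring in a
   fixed program have bounded size, so this is unit cost up to a constant. *)
Inductive exec (R : realType) : cmd -> state R -> nat -> state R -> Prop :=
| ExecSkip s : exec CSkip s 1 s
| ExecNSet s a i j e :
    exec (CNSet a i j e) s 1
      (State (upd (nmem s) a (neval s i) (neval s j) (neval s e)) (rmem s))
| ExecRSet s a i j e :
    exec (CRSet a i j e) s 1
      (State (nmem s) (upd (rmem s) a (neval s i) (neval s j) (reval s e)))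
| ExecSeq c1 c2 s s1 s2 t1 t2 :
    exec c1 s t1 s1 -> exec c2 s1 t2 s2 -> exec (CSeq c1 c2) s (t1 + t2) s2
| ExecIfTrue b c1 c2 s s1 t :
    beval s b -> exec c1 s t s1 -> exec (CIf b c1 c2) s t.+1 s1
| ExecIfFalse b c1 c2 s s1 t :
    ~~ beval s b -> exec c2 s t s1 -> exec (CIf b c1 c2) s t.+1 s1
| ExecWhileFalse b c s :
    ~~ beval s b -> exec (CWhile b c) s 1 s
| ExecWhileTrue b c s s1 s2 t1 t2 :
    beval s b -> exec c s t1 s1 -> exec (CWhile b c) s1 t2 s2 ->
    exec (CWhile b c) s (t1 + t2).+1 s2.

(* Input convention: natural array 0 holds n at [0, 0], natural array 1 holds
   the indicator of T at [i, 0], real array 0 holds eps at [0, 0], and real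
   array 1 holds the distance matrix; every other cell is 0. *)
Definition init_state (R : realType) (n : nat) (delta : 'I_n -> 'I_n -> R)
    (T : {set 'I_n}) (eps : R) : state R :=
  State
    (fun a i j =>
       match a, i, j with
       | 0, 0, 0 => n
       | 1, _, 0 => if insub i is Some k then nat_of_bool (k \in T) else 0%N
       | _, _, _ => 0%N
       end)
    (fun a i j =>
       match a, i, j with
       | 0, 0, 0 => eps
       | 1, _, _ =>
           if (insub i, insub j) is (Some k, Some l) then delta k l else 0
       | _, _, _ => 0
       end).

(* Output convention: the edge {i, j} is selected when cell [i, j] or [j, i] of
   natural array 2 is nonzero. *)
Definition output_graph (R : realType) (n : nat) (s : state R) : rel 'I_n :=
  fun i j => (i != j) && ((nmem s 2 i j != 0%N) || (nmem s 2 j i != 0%N)).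

(* Main.v *)
(* The spanner is built by a gap greedy: the pairs of terminals are scanned in any
   order, and (x, y) is selected unless some selected (k, l) satisfies
   4 (d(x, k) + d(y, l)) <= eps d(x, y).  The stretch bound follows by induction
   on d(x, y).  For the lightness, let W be the weight of a minimum Steiner tree
   and consider the selected pairs of length in [L, 2L).  Rounding endpoints to an
   (eps L / 16)-net of T is injective on them.  Extending this net to a net of the
   whole space, the correlation dimension bounds their number by
   A = (68 / eps)^d n; and as the net of T has at most 128 W / (eps L) points,
   their number is also at most B / L^2 with B = (128 W / eps)^2.  The sums
   over dyadic L of A L below L = sqrt(B / A) and of B / L above are both
   geometric, so the total weight is O(sqrt(A B)), with no log n factor. *)
Require Import Defs.
From HB Require Import structures.
From mathcomp Require Import all_boot all_order all_algebra.
From mathcomp Require Import all_classical all_reals all_analysis.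
From mathcomp Require Import zify ring lra.
Import Order.TTheory GRing.Theory Num.Theory.
Set Implicit Arguments.
Unset Strict Implicit.
Unset Printing Implicit Defensive.
Local Open Scope ring_scope.

(** * Nets and packings *)

(** A largest packing between [N0] and [Y] is a net, since an uncovered point of [Y] could be added
    to it. Prescribing [N0] later places a net of the terminals inside a net of the whole space. *)
Lemma rnet_extend (R : realType) (X : finType) (delta : X -> X -> R) (r : R)
    (Y N0 : {set X}) :
  is_metric delta -> N0 \subset Y -> 0 < r ->
  (forall p q, p \in N0 -> q \in N0 -> p != q -> r < delta p q) ->
  exists2 N : {set X}, N0 \subset N & is_rnet delta r Y N.
Proof.
move=> [d_ge0 d0 dC _] N0Y r_gt0 packN0.
pose packing (N : {set X}) := [&& N0 \subset N, N \subset Y &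
  [forall p in N, forall q in N, (p != q) ==> (r < delta p q)]].
have packP (N : {set X}) : reflect [/\ N0 \subset N, N \subset Y &
    forall p q, p \in N -> q \in N -> p != q -> r < delta p q] (packing N).
  apply: (iffP and3P) => -[? ? pk]; split=> //.
    by move=> p q pN qN; move: (forall_inP pk p pN) => /forall_inP/(_ q qN)/implyP.
  by apply/forall_inP=> p pN; apply/forall_inP=> q qN; apply/implyP; exact: pk.
have pack0 : packing N0 by apply/packP; split.
case: (arg_maxnP (fun N : {set X} => #|N|) pack0) => N /packP[N0N NY pk] maxN.
exists N => //; split=> // y yY.
apply: contrapT => /forall2NP Hy.
have far p : p \in N -> r < delta p y.
  by move=> pN; case: (Hy p) => // /negP; rewrite -ltNge.
have yN : y \notin N.
  by apply/negP => /far; rewrite (d0 y y).2 // ltNge ltW.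
have : packing (y |: N).
  apply/packP; split.
  - exact: fintype.subset_trans N0N (finset.subsetUr _ _).
  - by rewrite finset.subUset finset.sub1set yY.
  - move=> p q /setU1P[->|pN] /setU1P[->|qN]; rewrite ?eqxx // => pq.
    + by rewrite dC far.
    + exact: far.
    + exact: pk.
by move=> /maxN; rewrite cardsU1 yN add1n /= ltnn.
Qed.

Lemma rnet_exists (R : realType) (X : finType) (delta : X -> X -> R) (r : R)
    (Y : {set X}) :
  is_metric delta -> 0 < r -> exists N, is_rnet delta r Y N.
Proof.
move=> md r_gt0.
have pack0 p q : p \in finset.set0 -> q \in finset.set0 -> p != q -> r < delta p q.
  by rewrite inE.
by have [N _ netN] := rnet_extend md (finset.sub0set Y) r_gt0 pack0; exists N.
Qed.

Lemma sum_ball_pow2 (R : realType) (X : finType) (delta : X -> X -> R) (d : R)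
    (N : {set X}) (r : R) (k : nat) :
  corr_dim_bound delta d -> is_net delta N -> 0 < r ->
  (\sum_(x in N) #|ball_in delta N x (2 ^+ k * r)|)%N%:R
    <= (2 `^ d) ^+ k * (\sum_(x in N) #|ball_in delta N x r|)%N%:R.
Proof.
move=> cd netN r_gt0; elim: k => [|k IHk]; first by rewrite !expr0 !mul1r.
rewrite !exprS -!mulrA; apply: le_trans (cd _ _ netN _) _.
  by rewrite mulr_gt0 ?exprn_gt0.
by rewrite ler_wpM2l ?powR_ge0.
Qed.

(** At radius [r] every ball of an [r]-net is a singleton, so the [k] doublings start from
    [#|N|]. *)
Lemma rnet_card_pairs (R : realType) (X : finType) (delta : X -> X -> R) (d : R)
    (N : {set X}) (r : R) (k : nat) :
  is_metric delta -> corr_dim_bound delta d -> 0 < r ->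
  is_rnet delta r [set: X] N ->
  (\sum_(x in N) #|ball_in delta N x (2 ^+ k * r)|)%N%:R
    <= (2 `^ d) ^+ k * #|X|%:R.
Proof.
move=> [_ d0 _ _] cd r_gt0 netN; apply: le_trans (sum_ball_pow2 k cd _ r_gt0) _.
  by exists r.
rewrite ler_wpM2l ?exprn_ge0 ?powR_ge0 // ler_nat.
have [_ _ pk] := netN.
rewrite (eq_bigr (fun=> 1%N)) => [|x xN]; first by rewrite sum1_card max_card.
rewrite (_ : ball_in _ _ _ _ = [set x]) ?cards1 //; apply/setP=> y.
rewrite !inE; apply/idP/eqP => [/andP[yN dxy]|->].
  apply: contraTeq dxy => yx; rewrite -ltNge; apply: pk => //; by rewrite eq_sym.
by rewrite xN (d0 x x).2 // ltW.
Qed.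

(** * Packings against the weight of a connecting graph *)

Lemma path_zip (X : eqType) (M : rel X) (x : X) (p : seq X) :
  path M x p = all (fun e => M e.1 e.2) (zip (x :: p) p).
Proof. by elim: p x => //= y p IHp x; rewrite IHp. Qed.

(** Telescope [f] along a path without repeated vertices; it uses each oriented edge at most
    once. *)
Lemma connect_variation (R : realType) (X : finType) (M : rel X) (f : X -> R)
    (x y : X) :
  connect M x y ->
  f x - f y <= \sum_(u : X) \sum_(v : X | M u v) `|f u - f v|.
Proof.
move=> /connectP[p0 pth0 ->]; case: (shortenP pth0) => p pth up _ {p0 pth0}.
pose F := fun e : X * X => `|f e.1 - f e.2|.
have tele : f x - f (last x p) <= \sum_(e <- zip (x :: p) p) F e.
  elim: p x {pth up} => [|z p IHp] x /=; first by rewrite big_nil subrr.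
  rewrite big_cons -(subrKA (f z)) lerD ?ler_norm //; exact: IHp.
apply: le_trans tele _.
rewrite pair_big_dep /=.
have uz : uniq (zip (x :: p) p).
  by apply: (@map_uniq _ _ snd); rewrite -/(unzip2 _) unzip2_zip //=; case/andP: up.
rewrite [leLHS](big_uniq _ uz) /= [leLHS]big_mkcond [leRHS]big_mkcond /=.
apply: ler_sum => e _; case: ifP => [ez|_]; last by case: ifP.
by move: pth; rewrite path_zip => /allP/(_ e ez) ->.
Qed.

(** Two points of [N] closer than [r / 2] to [u] would be closer than [r] to each other. *)
Lemma card_packing_near (R : realType) (X : finType) (delta : X -> X -> R)
    (N : {set X}) (r : R) (u : X) :
  is_metric delta ->
  (forall p q, p \in N -> q \in N -> p != q -> r < delta p q) ->
  \sum_(p in N) (delta p u < r / 2)%R%:R <= 1 :> R.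
Proof.
move=> [_ _ dC tri] pk; rewrite -natr_sum -[1]/(1%:R) ler_nat.
rewrite -big_mkcondr sum1dep_card; apply/card_le1_eqP => p q.
rewrite !inE => /andP[pN pu] /andP[qN qu].
apply/eqP; apply: contraT => pq; have pqr := pk p q pN qN.
rewrite eq_sym in pqr; have := pqr pq; have := tri p u q; rewrite (dC u q); lra.
Qed.

(* The cone functions max(0, r/2 - delta(p, .)), p in N, have disjoint supports,
   and each of them varies by r/2 along M. *)
Lemma packing_card_weight (R : realType) (X : finType) (delta : X -> X -> R)
    (N : {set X}) (M : rel X) (r : R) :
  is_metric delta -> 0 < r -> (1 < #|N|)%N ->
  (forall p q, p \in N -> q \in N -> p != q -> r < delta p q) ->
  (forall p q, p \in N -> q \in N -> connect M p q) ->
  #|N|%:R * r <= 8 * weight delta M.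
Proof.
move=> md r_gt0 N_gt1 pk conM; have [d_ge0 d0 dC tri] := md.
pose f p v := Num.max 0 (r / 2 - delta p v).
have var_p p : p \in N ->
    r / 2 <= \sum_(u : X) \sum_(v : X | M u v) `|f p u - f p v|.
  move=> pN; have [q qN qp] : exists2 q, q \in N & q != p.
    have /card_gt0P[q] : (0 < #|N :\ p|)%N by move: N_gt1; rewrite (cardsD1 p) pN.
    by rewrite !inE => /andP[]; exists q.
  apply: le_trans (connect_variation (f p) (conM _ _ pN qN)).
  have pq := pk p q pN qN; rewrite eq_sym in pq; have {}pq := pq qp.
  rewrite /f (d0 p p).2 // subr0 max_r; last by lra.
  rewrite max_l; lra.
(* Each cone is 1-Lipschitz, and it is constant along the edge unless its support contains [u] or
   [v]; each endpoint lies in at most one support. *)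
have var_e u v : \sum_(p in N) `|f p u - f p v| <= 2 * delta u v.
  apply: (@le_trans _ _ (\sum_(p in N) ((delta p u < r / 2)%R%:R * delta u v
                                   + (delta p v < r / 2)%R%:R * delta u v))).
    apply: ler_sum => p _.
    have := tri p u v; have := tri p v u; rewrite (dC v u) /f.
    have := d_ge0 u v.
    case: (ltP (delta p u)) => hu; case: (ltP (delta p v)) => hv; rewrite /=.
    - rewrite max_r ?max_r; try lra; rewrite ler_norml; move=> *; lra.
    - rewrite max_r ?max_l; try lra; rewrite ler_norml; move=> *; lra.
    - rewrite max_l ?max_r; try lra; rewrite ler_norml; move=> *; lra.
    - rewrite max_l ?max_l; try lra; rewrite subrr normr0; move=> *; lra.
  rewrite big_split -!mulr_suml mulrDl mul1r.
  by apply: lerD; rewrite ler_piMl //; exact: card_packing_near.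
have : #|N|%:R * (r / 2)
    <= \sum_(p in N) \sum_(u : X) \sum_(v : X | M u v) `|f p u - f p v|.
  by rewrite mulr_natl -sumr_const; exact: ler_sum.
rewrite exchange_big /= => h.
have : \sum_(u : X) \sum_(p in N) \sum_(v : X | M u v) `|f p u - f p v|
    <= \sum_(u : X) \sum_(v : X | M u v) 2 * delta u v.
  by apply: ler_sum => u _; rewrite exchange_big /=; apply: ler_sum.
(* As [weight] halves the double sum, the right-hand side is [4 * weight delta M], against
   [#|N| * (r / 2)] on the left. *)
rewrite /weight; under [leRHS]eq_bigr do rewrite -mulr_sumr.
rewrite -mulr_sumr; lra.
Qed.

(** * Dyadic summation *)

(** Peel off the class [[L, 2L)]: it contributes at most [(B / L^2) * 2L = 2B / L], and the
    induction hypothesis at [2L] gives the other [2B / L]. *)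
Lemma dyadic_sum_ge (R : realType) (E : finType) (P : {set E}) (w : E -> R)
    (B L : R) :
  0 <= B ->
  (forall K, 0 < K -> #|[set e in P | K <= w e < 2 * K]|%:R <= B / K ^+ 2) ->
  0 < L -> \sum_(e in P | L <= w e) w e <= 4 * B / L.
Proof.
move=> B_ge0 cnt L_gt0.
have [k hk] : exists k : nat, forall e, w e < L * 2 ^+ k.
  pose m := \sum_(e : E) `|w e|.
  exists (Num.Def.archi_bound (m / L)) => e.
  apply: (@le_lt_trans _ _ m).
    by rewrite /m (bigD1 e) //= (le_trans (ler_norm _)) // lerDl sumr_ge0.
  rewrite mulrC -ltr_pdivrMr //.
  have m_ge0 : 0 <= m / L by rewrite divr_ge0 ?sumr_ge0 // ltW.
  apply: lt_trans (archi_boundP m_ge0) _.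
  by rewrite -natrX ltr_nat ltn_expl.
elim: k L L_gt0 hk => [|k IHk] L L_gt0 hk.
  rewrite big_pred0 => [|e]; first by rewrite divr_ge0 ?mulr_ge0 // ltW.
  by rewrite leNgt -[L]mulr1 hk andbF.
have L2_gt0 : 0 < 2 * L by rewrite mulr_gt0.
have hk2 e : w e < 2 * L * 2 ^+ k by rewrite mulrAC mulrC -exprS.
have IH := IHk _ L2_gt0 hk2.
rewrite (bigID (fun e => w e < 2 * L)) /=.
have -> : \sum_(e | (e \in P) && (L <= w e) && ~~ (w e < 2 * L)) w e
    = \sum_(e in P | 2 * L <= w e) w e.
  apply: eq_bigl => e; rewrite -andbA -leNgt; case: (leP (2 * L)) => h; rewrite ?andbF //.
  by have -> : L <= w e by lra.
have : \sum_(e | (e \in P) && (L <= w e) && (w e < 2 * L)) w e <= B / L ^+ 2 * (2 * L).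
  apply: (@le_trans _ _ (\sum_(e in [set e in P | L <= w e < 2 * L]) (2 * L))).
    rewrite [leRHS]big_mkcond [leLHS]big_mkcond.
    apply: ler_sum => e _; rewrite !inE.
    by rewrite -andbA; case: ifP => // /andP[_ /andP[_ /ltW]].
  by rewrite sumr_const -[leLHS]mulr_natl ler_wpM2r ?cnt // ltW.
move: IH.
have -> : B / L ^+ 2 * (2 * L) = 2 * B / L by field; rewrite gt_eqF.
have -> : 4 * B / (2 * L) = 2 * B / L by field; rewrite gt_eqF.
have -> : 4 * B / L = 2 * B / L + 2 * B / L by field; rewrite gt_eqF.
by move=> h1 h2; apply: lerD.
Qed.

(** The same induction downwards: the class [[L/2, L)] contributes at most [A * L], and the weights
    below [L / 2] at most [2 * A * (L / 2)]. Weight 0 lies in no dyadic class, hence the restriction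
    to positive weights. *)
Lemma dyadic_sum_lt (R : realType) (E : finType) (P : {set E}) (w : E -> R)
    (A L : R) :
  0 <= A ->
  (forall K, 0 < K -> #|[set e in P | K <= w e < 2 * K]|%:R <= A) ->
  0 < L -> \sum_(e in P | 0 < w e < L) w e <= 2 * A * L.
Proof.
move=> A_ge0 cnt L_gt0.
have [k hk] : exists k : nat, forall e, 0 < w e -> L <= w e * 2 ^+ k.
  pose m := \sum_(e : E) `|L / w e|.
  exists (Num.Def.archi_bound m) => e we.
  rewrite mulrC -ler_pdivrMr //.
  apply: (@le_trans _ _ m).
    by rewrite /m (bigD1 e) //= (le_trans (ler_norm _)) // lerDl sumr_ge0.
  have m_ge0 : 0 <= m by exact: sumr_ge0.
  apply: le_trans (ltW (archi_boundP m_ge0)) _.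
  by rewrite -natrX ler_nat ltnW // ltn_expl.
elim: k L L_gt0 hk => [|k IHk] L L_gt0 hk.
  rewrite big_pred0 => [|e]; first by rewrite !mulr_ge0 // ltW.
  case: (ltP 0 (w e)) => we; rewrite ?andbF //=.
  by rewrite ltNge -[w e]mulr1 hk ?andbF.
have L2_gt0 : 0 < L / 2 by rewrite divr_gt0.
have hk2 e : 0 < w e -> L / 2 <= w e * 2 ^+ k.
  by move=> /hk; rewrite ler_pdivrMr // exprS mulrCA mulrC.
have IH := IHk _ L2_gt0 hk2.
rewrite (bigID (fun e => w e < L / 2)) /=.
have -> : \sum_(e | (e \in P) && (0 < w e < L) && (w e < L / 2)) w e
    = \sum_(e in P | 0 < w e < L / 2) w e.
  apply: eq_bigl => e; rewrite -!andbA; case: (ltP (w e) (L / 2)) => h; rewrite ?andbF //.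
  by rewrite (lt_trans h) ?andbT //; move: L_gt0; lra.
have : \sum_(e | (e \in P) && (0 < w e < L) && ~~ (w e < L / 2)) w e <= A * L.
  apply: (@le_trans _ _ (\sum_(e in [set e in P | L / 2 <= w e < 2 * (L / 2)]) L)).
    rewrite [leRHS]big_mkcond [leLHS]big_mkcond.
    apply: ler_sum => e _; rewrite !inE -leNgt [2 * _]mulrC divfK //.
    case: ifP => [/andP[/andP[eP /andP[_ hw]] ->]|_]; first by rewrite eP hw ltW.
    by case: ifP => // _; rewrite ltW.
  by rewrite sumr_const -[leLHS]mulr_natl ler_wpM2r ?cnt // ltW.
have -> : 2 * A * L = 2 * A * (L / 2) + A * L by field.
by move=> h; apply: lerD.
Qed.

(** * Steiner trees and stretch *)

(** The star centred at [x0] is one Steiner tree, and there are only finitely many graphs on [X] to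
    minimise over. *)
Lemma min_steiner_tree_exists (R : realType) (X : finType)
    (delta : X -> X -> R) (T : {set X}) (x0 : X) :
  exists V M, is_min_steiner_tree delta T V M.
Proof.
pose star (x y : X) := (x != y) && ((x == x0) || (y == x0)).
have star_tree : is_steiner_tree T [set: X] star.
  split; last exact: finset.subsetT.
  have starC : symmetric star by move=> x y; rewrite /star eq_sym orbC.
  split.
  - by split=> // x; rewrite /star eqxx.
  - by move=> x y _; rewrite !inE.
  - move=> x y _ _.
    have to0 z : connect star z x0.
      have [->|zx] := eqVneq z x0; first exact: connect0.
      by apply: connect1; rewrite /star zx eqxx orbT.
    apply: connect_trans (to0 x) _; by rewrite (sym_connect_sym starC).
  (* Let [a, b, c] start a cycle. If [b] is the centre, the edge leaving [c] avoids [b], so [c]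
     would be the centre too; otherwise both [a] and [c] are the centre. *)
  - case=> [|a [|b [|c s]]] //=.
    rewrite /ucycle /= => /andP[cyc /and3P[a_notin b_notin _]].
    case/and3P: cyc => /andP[ab ab0] /andP[bc bc0] cyc; exfalso.
    have [bx|bx] := eqVneq b x0.
      have [e ce eb] : exists2 e, star c e & e != b.
        case: s cyc a_notin b_notin => [|e s] /andP[ce _]; rewrite !inE !negb_or.
          by move=> /andP[ab' _] _; exists a.
        by move=> _ /and3P[_ be _]; exists e => //; rewrite eq_sym.
      move: ce; rewrite /star -bx (negPf eb) orbF => /andP[_ /eqP cb].
      by rewrite cb eqxx in bc.
    move: ab0 bc0 a_notin; rewrite (negPf bx) orbF /= => /eqP-> /eqP->.
    by rewrite !inE eqxx orbT.
(* Relations are encoded as finite functions, so that the minimum ranges over a finite type. *)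
pose graph_of (F : {set X} * {ffun X * X -> bool}) : rel X := fun x y => F.2 (x, y).
have graph_ofK V M : graph_of (V, [ffun e => M e.1 e.2]) = M.
  by apply/funext => x; apply/funext => y; rewrite /graph_of ffunE.
have star_ok : `[< is_steiner_tree T [set: X]
    (graph_of ([set: X]%SET, [ffun e => star e.1 e.2])) >].
  by rewrite graph_ofK; exact/asboolP.
pose F0 := ([set: X]%SET, [ffun e : X * X => star e.1 e.2]).
case: (@arg_minP _ _ _ F0 (fun F => `[< is_steiner_tree T F.1 (graph_of F) >])
  (fun F => weight delta (graph_of F)) star_ok) => F /asboolP F_tree F_min.
exists F.1, (graph_of F); split=> // V' M' tree'.
rewrite -(graph_ofK V' M'); apply: F_min; apply/asboolP.
by rewrite graph_ofK.
Qed.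

Lemma walk_weight_cons (R : realType) (X : finType) (delta : X -> X -> R)
    (x y : X) (p : seq X) :
  walk_weight delta x (y :: p) = delta x y + walk_weight delta y p.
Proof. by rewrite /walk_weight /= big_cons. Qed.

Lemma walk_weight_cat (R : realType) (X : finType) (delta : X -> X -> R)
    (x : X) (p q : seq X) :
  walk_weight delta x (p ++ q)
    = walk_weight delta x p + walk_weight delta (last x p) q.
Proof.
elim: p x => [|y p IHp] x /=; first by rewrite {2}/walk_weight /= big_nil add0r.
by rewrite !walk_weight_cons IHp addrA.
Qed.

(* Induction on delta x y: a pair is replaced by a selected edge close to it and
   two pairs joining the endpoints, which are shorter by a factor eps / 4. *)
Lemma gap_cover_spanner (R : realType) (X : finType) (delta : X -> X -> R)
    (T : {set X}) (eps : R) (P : rel X) (S : rel X) :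
  is_metric delta -> 0 < eps < 1 -> is_graph S ->
  (forall k l, P k l -> [/\ k \in T, l \in T & (k == l) || S k l]) ->
  (forall x y, x \in T -> y \in T ->
     exists k l, P k l /\ 4 * (delta x k + delta y l) <= eps * delta x y) ->
  is_subset_spanner delta T eps S.
Proof.
move=> md eps01 gS PS cover; split=> // x y xT yT.
have [d_ge0 d0 dC tri] := md; have /andP[eps0 eps1] := eps01.
suff [p [pth lst wp]] : exists p, [/\ path S x p, last x p = y &
    walk_weight delta x p <= (1 + eps) * delta x y].
  apply: (@le_trans _ _ (walk_weight delta x p)%:E); last by rewrite lee_fin.
  by apply: ereal_inf_lbound; exists p.
(* Distances are real numbers, so the induction runs on the number of pairs that are strictly
   shorter. *)
pose shorter (x y : X) := [set e : X * X | delta e.1 e.2 < delta x y].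
have [m] := ubnP #|shorter x y|.
elim: m x y xT yT => // m IHm x y xT yT; rewrite ltnS => le_m.
have [<-|xy] := eqVneq x y.
  by exists [::]; rewrite /walk_weight big_nil mulr_ge0 ?addr_ge0 // ltW.
have dxy : 0 < delta x y.
  by rewrite lt_neqAle d_ge0 andbT eq_sym; apply: contraNneq xy => /d0->.
have [k [l [Pkl ckl]]] := cover _ _ xT yT.
have [kT lT Skl] := PS _ _ Pkl.
have rec u v : u \in T -> v \in T -> delta u v < delta x y ->
    exists p, [/\ path S u p, last u p = v &
      walk_weight delta u p <= (1 + eps) * delta u v].
  move=> uT vT duv; apply: IHm => //; apply: leq_trans le_m.
  apply/proper_card/properP; split.
    by apply/fintype.subsetP => e; rewrite !inE => /lt_trans; apply.
  by exists (u, v); rewrite !inE // ltxx.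
have := d_ge0 x k; have := d_ge0 y l => yl xk.
have e_d : eps * delta x y < delta x y by rewrite gtr_pMl.
have [p [pth lp wp]] : exists p, [/\ path S x p, last x p = k &
      walk_weight delta x p <= (1 + eps) * delta x k] by apply: rec => //; lra.
have [q [qth lq wq]] : exists p, [/\ path S l p, last l p = y &
      walk_weight delta l p <= (1 + eps) * delta l y].
  by apply: rec; rewrite // dC; lra.
have [e [eth le we]] : exists e, [/\ path S k e, last k e = l &
      walk_weight delta k e <= delta k l].
  (* A selected pair may be a loop, which is no edge of [S]; the middle walk is then empty. *)
  case/orP: Skl => [/eqP<-|Skl].
    by exists [::]; rewrite /walk_weight big_nil.
  exists [:: l]; rewrite /= andbT; split=> //.
  by rewrite /walk_weight big_seq1.
exists (p ++ e ++ q); split.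
- by rewrite !cat_path pth lp eth le qth.
- by rewrite !last_cat lp le.
- rewrite !walk_weight_cat lp le; move: wp wq we; rewrite (dC l y) => wp wq we.
  have := tri k x l; have := tri x y l; rewrite (dC k x) => t1 t2.
  (* With [s = delta x k + delta y l], the walk weighs at most [delta x y + (2 + eps) * s], and [(2
     + eps) * s <= 4 * s <= eps * delta x y]. *)
  have : eps * (delta x k + delta y l) <= delta x k + delta y l.
    by rewrite ler_piMl ?addr_ge0 // ltW.
  lra.
Qed.

(** * Lightness *)

Lemma pow2_between (R : realType) (x : R) :
  1 <= x -> exists k : nat, x <= 2 ^+ k <= 2 * x.
Proof.
move=> x_ge1; have x_ge0 : 0 <= x by apply: le_trans x_ge1.
have ex : exists k : nat, x <= 2 ^+ k.
  exists (Num.Def.archi_bound x); apply: le_trans (ltW (archi_boundP x_ge0)) _.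
  by rewrite -natrX ler_nat ltnW // ltn_expl.
case: (ex_minnP ex) => -[|k] xk mink.
  by exists 0%N; rewrite xk expr0; lra.
exists k.+1; rewrite xk exprS ler_pM2l //= ltW // ltNge.
by apply/negP => /mink; rewrite ltnn.
Qed.

Lemma powR_powX (R : realType) (x d : R) (k : nat) :
  0 <= x -> (x `^ d) ^+ k = (x ^+ k) `^ d.
Proof.
move=> x0; rewrite -powR_mulrn ?powR_ge0 // -powRrM mulrC powRrM.
by rewrite powR_mulrn.
Qed.

(** Ball sums over a nonempty net are positive and grow with the radius, which forces [2 ^ d >= 1].
    The sign makes the power with exponent [d] monotone in its base. *)
Lemma corr_dim_bound_ge0 (R : realType) (X : finType) (delta : X -> X -> R)
    (d : R) (x0 : X) :
  is_metric delta -> corr_dim_bound delta d -> 0 <= d.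
Proof.
move=> md cd; have [_ d0 _ _] := md.
have [N netN] := rnet_exists [set: X] md ltr01.
have [_ cov _] := netN; have [p pN _] := cov x0 (finset.in_setT x0).
pose S r := (\sum_(x in N) #|ball_in delta N x r|)%N.
have S1_gt0 : (0 < S 1%R)%N.
  rewrite /S (bigD1 p) //= addn_gt0; apply/orP; left; apply/card_gt0P.
  by exists p; rewrite inE pN (d0 p p).2 ?ler01.
have S12 : (S 1%R <= S (2 * 1)%R)%N.
  apply: leq_sum => x _; apply/subset_leq_card/fintype.subsetP => y.
  by rewrite !inE => /andP[-> h] /=; apply: le_trans h _; rewrite mulr1 ler1n.
have netN' : is_net delta N by exists 1.
have h : (S 1%R)%:R <= 2 `^ d * (S 1%R)%:R :> R.
  by apply: le_trans (cd N 1 netN' ltr01); rewrite ler_nat.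
have : 1 <= 2 `^ d :> R.
  by move: h; rewrite -{1}[(S 1%R)%:R]mul1r ler_pM2r // ltr0n.
apply: contraLR; rewrite -!ltNge => d_lt0.
have -> : d = - (- d) by rewrite opprK.
rewrite powRN invf_lt1 ?powR_gt0 //.
have : 1 `^ (- d) < 2 `^ (- d) :> R.
  by rewrite gt0_ltr_powR ?oppr_gt0 ?nnegrE // ltr1n.
by rewrite powR1.
Qed.

(** The greedy tests only the later of two pairs against the earlier one; the minimum makes the
    condition independent of the scanning order. *)
Definition gap_separated (R : realType) (X : finType) (delta : X -> X -> R)
    (eps : R) (P : {set X * X}) : Prop :=
  forall e f, e \in P -> f \in P -> e != f ->
    Num.min (delta e.1 e.2) (delta f.1 f.2) * eps
      < 4 * (delta e.1 f.1 + delta e.2 f.2).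

(* The radius eps * L / 16 is chosen so that rounding both endpoints of two pairs
   to common net points costs at most eps * L / 4 in total. *)
Lemma class_packing (R : realType) (X : finType) (delta : X -> X -> R)
    (T : {set X}) (P : {set X * X}) (eps L : R) :
  is_metric delta -> 0 < eps < 1 -> 0 < L ->
  (forall e, e \in P -> (e.1 \in T) && (e.2 \in T)) ->
  gap_separated delta eps P ->
  exists (N : {set X}) (phi : X -> X),
    [/\ is_rnet delta (eps * L / 16) T N,
        forall x, x \in T -> phi x \in N /\ delta (phi x) x <= eps * L / 16 &
        {in [set e in P | L <= delta e.1 e.2 < 2 * L] &,
           injective (fun e => (phi e.1, phi e.2))}].
Proof.
move=> md /andP[eps0 eps1] L0 PT gap; have [d_ge0 d0 dC tri] := md.
set r := eps * L / 16.
have r_gt0 : 0 < r by rewrite divr_gt0 ?mulr_gt0.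
have [N netN] := rnet_exists T md r_gt0.
have [_ cov _] := netN.
(* The default [x] is never taken on [T], which [N] covers. *)
pose phi x := odflt x [pick p in N | delta p x <= r].
have phiP x : x \in T -> phi x \in N /\ delta (phi x) x <= r.
  move=> /cov[p pN dp]; rewrite /phi; case: pickP => [q /andP[]//|/(_ p)].
  by rewrite pN dp.
exists N, phi; split=> // e f.
rewrite !inE => /andP[eP /andP[Le _]] /andP[fP /andP[Lf _]] [] e1 e2.
apply/eqP; apply: contraT => ef; have := gap e f eP fP ef.
have /andP[e1T e2T] := PT e eP; have /andP[f1T f2T] := PT f fP.
have near x y : x \in T -> y \in T -> phi x = phi y -> delta x y <= 2 * r.
  move=> /phiP[_ dx] /phiP[_ dy] xy; rewrite -xy in dy.
  by have := tri x (phi x) y; rewrite (dC x (phi x)); lra.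
have h1 := near _ _ e1T f1T e1; have h2 := near _ _ e2T f2T e2.
(* Two pairs rounded alike have [4 * (2r + 2r) = eps * L] on the right of the strict gap inequality,
   while its left side is at least [eps * L]. *)
have h3 : L <= Num.min (delta e.1 e.2) (delta f.1 f.2) by rewrite le_min Le Lf.
have : L * eps <= Num.min (delta e.1 e.2) (delta f.1 f.2) * eps.
  by rewrite ler_pM2r.
rewrite /r in h1 h2; lra.
Qed.

(** Rounding injects the class into the pairs of net points at distance at most [2 ^ k * r], which
    the correlation dimension counts once the net of [T] is extended to a net of [X]. *)
Lemma class_card_corr (R : realType) (X : finType) (delta : X -> X -> R)
    (T : {set X}) (P : {set X * X}) (d eps L : R) :
  is_metric delta -> corr_dim_bound delta d -> 0 <= d -> 0 < eps < 1 -> 0 < L ->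
  (forall e, e \in P -> (e.1 \in T) && (e.2 \in T)) ->
  gap_separated delta eps P ->
  #|[set e in P | L <= delta e.1 e.2 < 2 * L]|%:R
    <= (68 / eps) `^ d * #|X|%:R.
Proof.
move=> md cd d_ge0 eps01 L0 PT gap; have /andP[eps0 eps1] := eps01.
have [dl_ge0 d0 dC tri] := md.
have [N0 [phi [[N0T _ pk] phiP phi_inj]]] := class_packing md eps01 L0 PT gap.
set r := eps * L / 16 in pk phiP *.
have r_gt0 : 0 < r by rewrite divr_gt0 ?mulr_gt0.
have [N /fintype.subsetP N0N netN] :=
  rnet_extend md (finset.subsetT N0) r_gt0 pk.
(* Rounded endpoints are at distance at most [2L + 2r <= 34/16 * L = (34 / eps) * r]. Passing to a
   power of 2 costs a factor 2, whence 68. *)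
have [k /andP[k_ge k_le]] : exists k : nat, 34 / eps <= 2 ^+ k <= 2 * (34 / eps).
  by apply: pow2_between; rewrite ler_pdivlMr //; lra.
have card_pairs := rnet_card_pairs k md cd r_gt0 netN.
apply: le_trans (_ : _ <= (2 `^ d) ^+ k * #|X|%:R) _; last first.
  rewrite ler_wpM2r // powR_powX // ge0_ler_powR ?nnegrE //.
  - by rewrite divr_ge0 // ltW.
  - by apply: le_trans k_le _; rewrite mulrA; lra.
apply: le_trans card_pairs; rewrite ler_nat -(card_in_imset phi_inj).
rewrite (eq_bigr (fun x => \sum_(y in ball_in delta N x (2 ^+ k * r)) 1)%N);
  last by move=> x _; rewrite sum1_card.
rewrite pair_big_dep /= sum1dep_card.
apply/subset_leq_card/fintype.subsetP => _ /imsetP[e + ->].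
rewrite !inE => /andP[eP /andP[_ eL]] /=; have /andP[e1T e2T] := PT e eP.
have [p1 q1] := phiP _ e1T; have [p2 q2] := phiP _ e2T.
rewrite !N0N //=.
have : 34 / eps * r <= 2 ^+ k * r by rewrite ler_pM2r.
have -> : 34 / eps * r = 34 / 16 * L by rewrite /r; field; rewrite gt_eqF.
have := tri (phi e.1) e.1 (phi e.2); have := tri e.1 e.2 (phi e.2).
rewrite (dC e.2 (phi _)).
have : r <= L / 16 by rewrite /r ler_pM2r // ger_pMl // ltW.
lra.
Qed.

(** Rounding injects the class into [N * N], and [packing_card_weight] bounds [#|N|] by
    [8 * weight delta M / r]. *)
Lemma class_card_weight (R : realType) (X : finType) (delta : X -> X -> R)
    (T : {set X}) (P : {set X * X}) (M : rel X) (eps L : R) :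
  is_metric delta -> 0 < eps < 1 -> 0 < L ->
  (forall x y, x \in T -> y \in T -> connect M x y) ->
  (forall e, e \in P -> (e.1 \in T) && (e.2 \in T)) ->
  gap_separated delta eps P ->
  #|[set e in P | L <= delta e.1 e.2 < 2 * L]|%:R
    <= (128 * weight delta M / eps) ^+ 2 / L ^+ 2.
Proof.
move=> md eps01 L0 conM PT gap; have /andP[eps0 eps1] := eps01.
have [dl_ge0 d0 dC tri] := md.
have [N [phi [[/fintype.subsetP NT _ pk] phiP phi_inj]]] :=
  class_packing md eps01 L0 PT gap.
set r := eps * L / 16 in pk phiP.
have r_gt0 : 0 < r by rewrite divr_gt0 ?mulr_gt0.
rewrite -expr_div_n -(card_in_imset phi_inj).
have [->|[e]] := set_0Vmem [set e in P | L <= delta e.1 e.2 < 2 * L].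
  by rewrite imset0 cards0 sqr_ge0.
rewrite inE => /andP[eP /andP[Le _]]; have /andP[e1T e2T] := PT e eP.
have [p1 q1] := phiP _ e1T; have [p2 q2] := phiP _ e2T.
(* A pair of length at least [L > 2r] has distinct rounded endpoints; this gives the two net points
   that the packing bound requires. *)
have phi_neq : phi e.1 != phi e.2.
  apply/eqP => phi_eq; rewrite -phi_eq in q2.
  have := tri e.1 (phi e.1) e.2; rewrite (dC e.1 (phi e.1)).
  have : r <= L / 16 by rewrite /r ler_pM2r // ger_pMl // ltW.
  lra.
have N_gt1 : (1 < #|N|)%N.
  by apply/card_gt1P; exists (phi e.1), (phi e.2).
have Nr : #|N|%:R * r <= 8 * weight delta M.
  by apply: packing_card_weight => // p q /NT pT /NT; exact: conM.
apply: (@le_trans _ _ (#|N|%:R ^+ 2)).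
  rewrite -natrX ler_nat expnS expn1 -cardsX; apply/subset_leq_card.
  apply/fintype.subsetP => _ /imsetP[f + ->]; rewrite inE => /andP[fP _].
  by rewrite inE /=; have /andP[/phiP[-> _] /phiP[-> _]] := PT f fP.
have -> : 128 * weight delta M / eps / L = 8 * weight delta M / r.
  by rewrite /r; field; rewrite !gt_eqF.
have bound : #|N|%:R <= 8 * weight delta M / r by rewrite ler_pdivlMr.
by rewrite ler_sqr ?nnegrE // (le_trans _ bound).
Qed.

(** The two class bounds agree at [K = b / sqrt A]; splitting there leaves [4 * b * sqrt A] above
    and [2 * b * sqrt A] below. *)
Lemma dyadic_sum_le (R : realType) (E : finType) (P : {set E}) (w : E -> R)
    (A b : R) :
  0 < A -> 0 <= b -> (forall e, 0 <= w e) ->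
  (forall K, 0 < K -> #|[set e in P | K <= w e < 2 * K]|%:R <= A) ->
  (forall K, 0 < K -> #|[set e in P | K <= w e < 2 * K]|%:R <= b ^+ 2 / K ^+ 2) ->
  \sum_(e in P) w e <= 6 * (b * Num.sqrt A).
Proof.
move=> A0 b0 w0 cntA cntB.
have sA : 0 < Num.sqrt A by rewrite sqrtr_gt0.
have b2 : 0 <= b ^+ 2 by exact: sqr_ge0.
(* For [b = 0] the splitting point would be 0; here the upper sum taken from [L = w e] shows that
   each weight vanishes. *)
have [bz|b_neq0] := eqVneq b 0.
  rewrite bz mul0r mulr0 big1 // => e eP; apply/eqP; rewrite eq_le w0 andbT.
  rewrite leNgt; apply/negP => we.
  have := dyadic_sum_ge b2 cntB we; rewrite bz expr0n mulr0 mul0r.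
  rewrite (bigD1 e) /= ?eP ?lexx // => h.
  have : 0 <= \sum_(i in P | (w e <= w i) && (i != e)) w i by exact: sumr_ge0.
  rewrite (eq_bigl (fun i => [&& i \in P, w e <= w i & i != e])) // => h'.
  move: h; rewrite (eq_bigl (fun i => [&& i \in P, w e <= w i & i != e])) //.
    lra.
  by move=> i; rewrite andbA.
have b_gt0 : 0 < b by rewrite lt_def b_neq0.
have L0 : 0 < b / Num.sqrt A by rewrite divr_gt0.
have hi := dyadic_sum_ge b2 cntB L0; have lo := dyadic_sum_lt (ltW A0) cntA L0.
have eA : A = Num.sqrt A ^+ 2 by rewrite sqr_sqrtr ?ltW.
rewrite (bigID (fun e => b / Num.sqrt A <= w e)) /=.
have -> : \sum_(e in P | ~~ (b / Num.sqrt A <= w e)) w e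
    = \sum_(e in P | 0 < w e < b / Num.sqrt A) w e.
  rewrite [LHS]big_mkcond [RHS]big_mkcond; apply: eq_bigr => e _.
  rewrite -ltNge; have := w0 e; rewrite le_eqVlt => /predU1P[<-|->] //.
  by rewrite ltxx /= andbF; case: ifP.
move: hi lo.
have -> : 4 * b ^+ 2 / (b / Num.sqrt A) = 4 * (b * Num.sqrt A).
  by field; rewrite b_neq0 gt_eqF.
have -> : 2 * A * (b / Num.sqrt A) = 2 * (b * Num.sqrt A).
  by rewrite {1}eA; field; rewrite gt_eqF.
lra.
Qed.

(** Each orientation of an edge of [S] is charged to [P] or to its reversal; both have the same
    total length, and [weight] halves the result. *)
Lemma weight_le_sum (R : realType) (X : finType) (delta : X -> X -> R)
    (P : {set X * X}) (S : rel X) :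
  is_metric delta -> (forall x y, S x y -> ((x, y) \in P) || ((y, x) \in P)) ->
  weight delta S <= \sum_(e in P) delta e.1 e.2.
Proof.
move=> [d_ge0 _ dC _] SP; rewrite /weight ler_pdivrMr // mulr_natr mulr2n.
have sumP : \sum_(e in P) delta e.1 e.2
    = \sum_(x : X) \sum_(y : X | (x, y) \in P) delta x y.
  by rewrite pair_big_dep /=; apply: eq_bigl => -[].
have sumPC : \sum_(e in P) delta e.1 e.2
    = \sum_(x : X) \sum_(y : X | (y, x) \in P) delta x y.
  rewrite sumP (exchange_big_dep xpredT) //=; apply: eq_bigr => x _.
  by apply: eq_bigr => y _; exact: dC.
rewrite {1}sumP sumPC -big_split; apply: ler_sum => x _ /=.
rewrite big_mkcond [X in _ <= X + _]big_mkcond [X in _ <= _ + X]big_mkcond.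
rewrite -big_split; apply: ler_sum => y _ /=.
case: ifP => [/SP|_]; last by rewrite addr_ge0 //; case: ifP.
by do 2!case: ifP => _ //=; rewrite ?addr0 ?add0r // lerDl.
Qed.

Lemma gap_weight (R : realType) (X : finType) (delta : X -> X -> R)
    (T : {set X}) (P : {set X * X}) (S M : rel X) (d eps : R) :
  is_metric delta -> corr_dim_bound delta d -> (0 < #|X|)%N -> 0 < eps < 1 ->
  (forall x y, x \in T -> y \in T -> connect M x y) ->
  (forall e, e \in P -> (e.1 \in T) && (e.2 \in T)) ->
  gap_separated delta eps P ->
  (forall x y, S x y -> ((x, y) \in P) || ((y, x) \in P)) ->
  weight delta S <=
    6 * (128 * weight delta M / eps * Num.sqrt ((68 / eps) `^ d * #|X|%:R)).
Proof.
move=> md cd X_gt0 eps01 conM PT gap SP; have [d_ge0 _ _ _] := md.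
have /card_gt0P[x0 _] := X_gt0; have /andP[eps0 _] := eps01.
have dim_ge0 := corr_dim_bound_ge0 x0 md cd.
apply: le_trans (weight_le_sum md SP) _.
apply: (dyadic_sum_le (w := fun e : X * X => delta e.1 e.2)) => //.
- by rewrite mulr_gt0 // ?ltr0n // powR_gt0 // divr_gt0.
- rewrite divr_ge0 ?(ltW eps0) // mulr_ge0 // divr_ge0 // sumr_ge0 // => x _.
  exact: sumr_ge0.
- by move=> L L0; exact: (class_card_corr md cd dim_ge0 eps01 L0 PT gap).
- by move=> L L0; exact: (class_card_weight md eps01 L0 conM PT gap).
Qed.

(** Here [768 = 6 * 128], and the square root turns [(68 / eps) ^ d] into [68 ^ (d / 2)] times
    [eps ^ (- d / 2)]. The remaining [eps^-1] is relaxed to [eps^-3] and multiplied by a factor at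
    least 1. *)
Lemma lightness_constant (R : realType) (d eps W : R) (n : nat) :
  0 < eps < 1 -> 0 <= W ->
  6 * (128 * W / eps * Num.sqrt ((68 / eps) `^ d * n%:R)) <=
  768 * 68 `^ (d / 2) * (1 + ln (eps^-1))
    * (eps `^ (- (d / 2 + 3)) * Num.sqrt n%:R) * W.
Proof.
move=> /andP[eps0 eps1] W0.
have eps_ge0 := ltW eps0.
rewrite sqrtrM ?powR_ge0 // -powR12_sqrt ?powR_ge0 // -powRrM.
rewrite powRM ?invr_ge0 // -(powR_inv1 eps_ge0).
rewrite -powRrM mulN1r opprD powRD; last by apply/implyP => _; rewrite gt_eqF.
have eps3 : eps^-1 <= eps `^ (- 3).
  rewrite -(powR_inv1 eps_ge0) ger_powR ?eps0 ?(ltW eps1) // lerN2 ler1n //.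
have ln_ge0 : 0 <= ln (eps^-1) by rewrite ln_ge0 // invf_ge1 // ltW.
rewrite powR_inv1 //; move: (68 `^ _) (powR_ge0 68 (d / 2)) => u u0.
move: (eps `^ (- (d / 2))) (powR_ge0 eps (- (d / 2))) => v v0.
move: (Num.sqrt n%:R) (sqrtr_ge0 (n%:R : R)) => q q0.
have K0 : 0 <= 768 * W * u * v * q by rewrite !mulr_ge0.
rewrite (_ : 6 * _ = 768 * W * u * v * q * eps^-1); last by ring.
rewrite [leRHS](_ : _ = 768 * W * u * v * q * (eps `^ (- 3) * (1 + ln eps^-1)));
  last by ring.
rewrite ler_wpM2l // (le_trans eps3) // ler_peMr ?powR_ge0 // lerDl //.
Qed.

(** * Program *)

(** A total-correctness judgement with a time budget: [exec] only derives halting runs, and the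
    inequality lets branches of different cost share one bound. *)
Definition runs (R : realType) (c : cmd) (s : state R) (t : nat)
    (Q : state R -> Prop) : Prop :=
  exists t' s', [/\ exec c s t' s', (t' <= t)%N & Q s'].

Lemma runs_weaken (R : realType) c (s : state R) t1 t2
    (Q1 Q2 : state R -> Prop) :
  runs c s t1 Q1 -> (t1 <= t2)%N -> (forall s', Q1 s' -> Q2 s') ->
  runs c s t2 Q2.
Proof.
move=> [t [s' [ex le_t Qs']]] le_t12 Q12; exists t, s'; split=> //.
- exact: leq_trans le_t12.
- exact: Q12.
Qed.

Lemma runs_seq (R : realType) c1 c2 (s : state R) t1 t2
    (Q1 Q2 : state R -> Prop) :
  runs c1 s t1 Q1 -> (forall s', Q1 s' -> runs c2 s' t2 Q2) ->
  runs (CSeq c1 c2) s (t1 + t2) Q2.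
Proof.
move=> [u1 [s1 [ex1 le1 Qs1]]] /(_ _ Qs1) [u2 [s2 [ex2 le2 Qs2]]].
exists (u1 + u2)%N, s2; split=> //; first exact: ExecSeq ex1 ex2.
exact: leq_add.
Qed.

Definition set_cell (R : realType) (s : state R) (a i j v : nat) : state R :=
  State (upd (nmem s) a i j v) (rmem s).

Lemma runs_nset (R : realType) (s : state R) a i j e t (Q : state R -> Prop) :
  Q (set_cell s a (neval s i) (neval s j) (neval s e)) ->
  runs (CNSet a i j e) s t.+1 Q.
Proof. by move=> Qs; do 2!eexists; split; [exact: ExecNSet | | exact: Qs]. Qed.

Lemma runs_if_skip (R : realType) b c (s : state R) t (Q : state R -> Prop) :
  (0 < t)%N -> (beval s b -> runs c s t Q) -> (~~ beval s b -> Q s) ->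
  runs (CIf b c CSkip) s t.+1 Q.
Proof.
move=> t_gt0 Qc Qskip; have [bT|bF] := boolP (beval s b).
- have [u [s' [ex le_u Qs']]] := Qc bT.
  by exists u.+1, s'; split=> //; exact: ExecIfTrue.
- exists 2%N, s; split=> //; last exact: Qskip.
  by apply: ExecIfFalse => //; exact: ExecSkip.
Qed.

(* Array 3 holds the program variables: the loop counters 0 to 3 and the flag 4,
   which records that a selected pair close to (var 0, var 1) was found. *)
Definition var (c : nat) : nexp := NCell 3 (NConst c) (NConst 0).

Definition set_var (c : nat) (e : nexp) : cmd :=
  CNSet 3 (NConst c) (NConst 0) e.

Definition input_size : nexp := NCell 0 (NConst 0) (NConst 0).

Definition for_loop (c : nat) (body : cmd) : cmd :=
  CSeq (set_var c (NConst 0))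
    (CWhile (BNLe (NAdd (var c) (NConst 1)) input_size)
      (CSeq body (set_var c (NAdd (var c) (NConst 1))))).

(** The invariant must expose the counter and the size, which the loop test reads. A round costs
    [t + 2] with its test and increment; the initial assignment and the last test fit in one extra
    round. *)
Lemma runs_for (R : realType) (n c : nat) body (s : state R) t
    (I : nat -> state R -> Prop) :
  (forall k s', I k s' -> nmem s' 3 c 0 = k /\ nmem s' 0 0 0 = n) ->
  I 0%N (set_cell s 3 c 0 0) ->
  (forall k s', (k < n)%N -> I k s' ->
     runs body s' t
       (fun s'' => nmem s'' 3 c 0 = k /\ I k.+1 (set_cell s'' 3 c 0 k.+1))) ->
  runs (for_loop c body) s ((t + 2) * n.+1) (I n).
Proof.
move=> Icell I0 step.
have loop m : forall k s', (k + m)%N = n -> I k s' ->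
    runs (CWhile (BNLe (NAdd (var c) (NConst 1)) input_size)
      (CSeq body (set_var c (NAdd (var c) (NConst 1))))) s'
      ((t + 2) * m + 1) (I n).
  elim: m => [|m IHm] k s' km Iks'.
    have [vk vn] := Icell _ _ Iks'.
    rewrite addn0 in km; rewrite km in vk Iks'.
    exists 1%N, s'; split=> //; first apply: ExecWhileFalse.
      by rewrite /= vk vn addn1 ltnn.
    by rewrite leq_addl.
  have [vk vn] := Icell _ _ Iks'.
  have ltkn : (k < n)%N by rewrite -km addnS ltnS leq_addr.
  have [u1 [s1 [ex1 le1 [vk1 Is1]]]] := step _ _ ltkn Iks'.
  have [u2 [s2 [ex2 le2 Is2]]] : runs (CWhile (BNLe (NAdd (var c) (NConst 1)) input_size)
      (CSeq body (set_var c (NAdd (var c) (NConst 1)))))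
      (set_cell s1 3 c 0 k.+1) ((t + 2) * m + 1) (I n).
    by apply: (IHm k.+1); rewrite ?addSnnS.
  exists ((u1 + 1) + u2).+1, s2; split=> //; last by lia.
  apply: ExecWhileTrue ex2; first by rewrite /= vk vn addn1.
  apply: ExecSeq ex1 _.
  have := ExecNSet s1 3 (NConst c) (NConst 0) (NAdd (var c) (NConst 1)).
  by rewrite /= vk1 addn1.
have seq_time : (1 + ((t + 2) * n + 1) <= (t + 2) * n.+1)%N by lia.
apply: (runs_weaken _ seq_time) => [|s' Hs']; last exact: Hs'.
apply: (runs_seq (Q1 := I 0%N)) => [|s' Is']; first exact: runs_nset.
exact: (loop n 0%N).
Qed.

(** * The gap greedy program and its correctness *)

Definition close_test : bexp :=
  let x := RAdd (RCell 1 (var 0) (var 2)) (RCell 1 (var 1) (var 3)) in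
  BRLe (RAdd (RAdd x x) (RAdd x x))
    (RMul (RCell 0 (NConst 0) (NConst 0)) (RCell 1 (var 0) (var 1))).

Definition search_step : cmd :=
  CIf (BAnd (BNLe (NConst 1) (NCell 2 (var 2) (var 3))) close_test)
    (set_var 4 (NConst 1)) CSkip.

Definition terminal_test (c : nat) : bexp :=
  BNLe (NConst 1) (NCell 1 (var c) (NConst 0)).

Definition select_step : cmd :=
  CIf (BAnd (BNLe (var 4) (NConst 0))
        (BAnd (terminal_test 0) (terminal_test 1)))
    (CNSet 2 (var 0) (var 1) (NConst 1)) CSkip.

Definition gap_greedy : cmd :=
  for_loop 0 (for_loop 1
    (CSeq (set_var 4 (NConst 0))
      (CSeq (for_loop 2 (for_loop 3 search_step)) select_step))).

(** Keeps the repeated doubling by which [close_test] expresses the factor 4, so that evaluating the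
    test folds back to it. *)
Definition close (R : realType) (m : nat -> nat -> nat -> R) (i j k l : nat) :
    bool :=
  (m 1 i k + m 1 j l + (m 1 i k + m 1 j l) +
   (m 1 i k + m 1 j l + (m 1 i k + m 1 j l)) <= m 0 0 0 * m 1 i j).

(** The program writes only to the natural arrays 2 and 3, so this is preserved by every loop. *)
Definition same_input (R : realType) (s s' : state R) : Prop :=
  [/\ rmem s' = rmem s, nmem s' 0 = nmem s 0 & nmem s' 1 = nmem s 1].

Lemma search_run (R : realType) (n i j : nat) (s0 s : state R) :
  same_input s0 s -> nmem s0 0 0 0 = n ->
  nmem s 3 0 0 = i -> nmem s 3 1 0 = j -> nmem s 3 4 0 = 0%N ->
  runs (for_loop 2 (for_loop 3 search_step)) s ((5 * n.+1 + 2) * n.+1)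
    (fun s' => [/\ same_input s0 s', nmem s' 2 = nmem s 2,
       nmem s' 3 0 0 = i, nmem s' 3 1 0 = j &
       nmem s' 3 4 0 = 0%N <->
       forall k l, (k < n)%N -> (l < n)%N -> nmem s 2 k l <> 0%N ->
         ~~ close (rmem s0) i j k l]).
Proof.
move=> sin size_n vi vj flag0.
(* The flag records the search over the pairs lexicographically before [(k, l)]. *)
pose Inv k l s' := [/\ same_input s0 s', nmem s' 2 = nmem s 2,
  nmem s' 3 0 0 = i, nmem s' 3 1 0 = j &
  nmem s' 3 4 0 = 0%N <->
  forall k' l', (k' < n)%N -> (l' < n)%N -> (k' < k)%N || (k' == k) && (l' < l)%N ->
    nmem s 2 k' l' <> 0%N -> ~~ close (rmem s0) i j k' l'].
have time : ((5 * n.+1 + 2) * n.+1 <= (5 * n.+1 + 2) * n.+1)%N by [].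
apply: (runs_weaken (Q1 := fun s' => nmem s' 3 2 0 = n /\ Inv n 0%N s') _ time).
  apply: (runs_for (I := fun k s1 => nmem s1 3 2 0 = k /\ Inv k 0%N s1)).
  - by move=> k s' [vk [[_ h0 _] _ _ _ _]]; rewrite vk h0.
  - split=> //; split=> //=; split=> // _ k' l' _ _; by rewrite ltn0 andbF.
  - move=> k s1 ltkn [vk inv1].
    pose J l s' := [/\ nmem s' 3 3 0 = l, nmem s' 3 2 0 = k & Inv k l s'].
    apply: (runs_weaken (Q1 := J n)) => [||s2 [vl2 vk2 [sin2 o2 vi2 vj2 f2]]].
    + apply: (runs_for (t := 3)).
      * by move=> l s' [vl vk' [[_ h0 _] _ _ _ _]]; rewrite vl h0.
      * by split.
      * move=> l s' ltln [vl vk' [[sr s00 s01] o' vi' vj' f']].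
        rewrite /search_step; apply: (runs_if_skip (t := 2)) => // /=.
        -- rewrite vl vk' vi' vj' o' sr -/(close _ _ _ _ _) => /andP[okl clo].
           apply: runs_nset; do 2!split=> //.
           split=> //; split=> //= all_far; exfalso.
           have := all_far k l ltkn ltln; rewrite eqxx ltnS leqnn orbT clo.
           have okl0 : nmem s 2 k l <> 0%N by apply/eqP; rewrite -lt0n.
           by move=> /(_ isT okl0).
        -- rewrite vl vk' vi' vj' o' sr -/(close _ _ _ _ _) => far.
           do 2!split=> //; split=> //=; rewrite {1}/upd /= f'; split=> H k' l' lt1 lt2.
             rewrite ltnS [(l' <= l)%N]leq_eqVlt andb_orr orbCA => /orP[|]; last exact: H.
             move=> /andP[/eqP-> /eqP->] /eqP; rewrite -lt0n => okl.
             by move: far; rewrite okl.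
           move=> lex; apply: H => //; move: lex; lia.
    + lia.
    (* Below [n], the pairs before [(k, n)] are exactly those before [(k + 1, 0)]. *)
    + do 2!split=> //; split=> //=; rewrite {1}/upd /= f2.
      split=> H k' l' lt1 lt2 lex; apply: H => //; move: lex; lia.
move=> s' [_ [sin' o' vi' vj' f']]; split=> //; rewrite f'.
split=> H k l lt1 lt2; first by apply: H; rewrite ?lt1.
by move=> _; exact: H.
Qed.

(** The second conclusion feeds the stretch bound and the third the lightness bound; its disjunction
    forgets which of the two pairs was scanned later. *)
Lemma gap_greedy_run (R : realType) (n : nat) (s0 : state R) :
  nmem s0 0 0 0 = n -> (forall k l, nmem s0 2 k l = 0%N) ->
  (forall x y, (x < n)%N -> (y < n)%N -> close (rmem s0) x y x y) ->
  runs gap_greedy s0 (16 * n.+1 ^ 4) (fun s =>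
    [/\ forall k l, nmem s 2 k l <> 0%N ->
          [/\ (k < n)%N, (l < n)%N, nmem s0 1 k 0 <> 0%N & nmem s0 1 l 0 <> 0%N],
        forall x y, (x < n)%N -> (y < n)%N ->
          nmem s0 1 x 0 <> 0%N -> nmem s0 1 y 0 <> 0%N ->
          exists k l, nmem s 2 k l <> 0%N /\ close (rmem s0) x y k l &
        forall x y k l, nmem s 2 x y <> 0%N -> nmem s 2 k l <> 0%N ->
          (x, y) != (k, l) ->
          ~~ close (rmem s0) x y k l \/ ~~ close (rmem s0) k l x y]).
Proof.
move=> size_n out0 close_refl.
pose Inv i j (s : state R) := [/\ same_input s0 s,
  forall k l, nmem s 2 k l <> 0%N ->
    [/\ (k < n)%N, (l < n)%N, nmem s0 1 k 0 <> 0%N & nmem s0 1 l 0 <> 0%N],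
  forall x y, (x < n)%N -> (y < n)%N ->
    nmem s0 1 x 0 <> 0%N -> nmem s0 1 y 0 <> 0%N ->
    (x < i)%N || (x == i) && (y < j)%N ->
    exists k l, nmem s 2 k l <> 0%N /\ close (rmem s0) x y k l &
  forall x y k l, nmem s 2 x y <> 0%N -> nmem s 2 k l <> 0%N ->
    (x, y) != (k, l) ->
    ~~ close (rmem s0) x y k l \/ ~~ close (rmem s0) k l x y].
have body_run i j (s : state R) : (i < n)%N -> (j < n)%N ->
    nmem s 3 0 0 = i -> nmem s 3 1 0 = j -> Inv i j s ->
    runs (CSeq (set_var 4 (NConst 0))
      (CSeq (for_loop 2 (for_loop 3 search_step)) select_step)) s
      (1 + ((5 * n.+1 + 2) * n.+1 + 2))
      (fun s' => [/\ nmem s' 3 0 0 = i, nmem s' 3 1 0 = j & Inv i j.+1 s']).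
  move=> lt_i lt_j vi vj [sin P1 P2 P3].
  apply: (runs_seq (Q1 := fun s1 => s1 = set_cell s 3 4 0 0)).
    exact: runs_nset.
  move=> s1 ->.
  apply: runs_seq.
    exact: (@search_run _ n i j s0 (set_cell s 3 4 0 0)).
  move=> s2 [sin2 o2 vi2 vj2 f2]; have [sr2 s02 s12] := sin2.
  have {}o2 : nmem s2 2 = nmem s 2 by [].
  apply: (runs_if_skip (t := 1)) => //=; rewrite vi2 vj2 s12.
  - move=> /and3P[]; rewrite leqn0 => /eqP/f2 far ti tj.
    have new k l : upd (nmem s2) 2 i j 1%N 2 k l <> 0%N ->
        (k, l) = (i, j) \/ nmem s 2 k l <> 0%N.
      rewrite /upd /=; case: ifP => [/andP[/eqP-> /eqP->]|_]; first by left.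
      by rewrite o2; right.
    have old k l : nmem s 2 k l <> 0%N -> upd (nmem s2) 2 i j 1%N 2 k l <> 0%N.
      by rewrite /upd /= o2; case: ifP.
    apply: runs_nset; rewrite /= vi2 vj2; split=> //; split=> //=.
    + move=> k l /new[[-> ->]|]; last exact: P1.
      by split=> //; apply/eqP; rewrite -lt0n.
    + move=> x y ltx lty tx ty lex.
      have [/eqP[-> ->]|xy] := boolP ((x, y) == (i, j)).
        exists i, j; split; first by rewrite /upd /= !eqxx.
        exact: close_refl.
      have [|k [l [okl ckl]]] := P2 x y ltx lty tx ty.
        by move: xy lex; rewrite xpair_eqE; lia.
      by exists k, l; split=> //; exact: old.
    + move=> x y k l /new[[-> ->]|oxy] /new[[-> ->]|okl]; rewrite ?eqxx // => neq.
      (* The new pair was tested against every selected pair; [P1] gives the index bounds under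
         which the search is exhaustive. *)
      * by left; have [? ? _ _] := P1 _ _ okl; exact: far.
      * by right; have [? ? _ _] := P1 _ _ oxy; exact: far.
      * exact: P3.
  - move=> skip; split=> //; split=> //=; rewrite o2 //.
    move=> x y ltx lty tx ty lex.
    have [/eqP[xi yj]|xy] := boolP ((x, y) == (i, j)); last first.
      by apply: P2 => //; move: xy lex; rewrite xpair_eqE; lia.
    (* Were no selected pair close to this one, the flag would be 0 and the two terminals would have
       been selected. *)
    subst x y; apply: contrapT => none; move/negP: skip; apply.
    rewrite !lt0n; apply/and3P; split; try exact/eqP.
    rewrite leqn0; apply/eqP/f2 => k l ltk ltl okl; apply/negP => ckl.
    by apply: none; exists k, l.
(* With [m = n + 1], the left side is [5 m^4 + 2 m^3 + 5 m^2 + 2 m]. *)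
have time : ((((1 + ((5 * n.+1 + 2) * n.+1 + 2)) + 2) * n.+1 + 2) * n.+1
    <= 16 * n.+1 ^ 4)%N.
  have : (1 <= n.+1)%N by []; move: n.+1 => m m1.
  rewrite !expnS expn0; nia.
apply: (runs_weaken (Q1 := fun s => nmem s 3 0 0 = n /\ Inv n 0%N s) _ time).
  apply: (runs_for (I := fun i s => nmem s 3 0 0 = i /\ Inv i 0%N s)).
  - by move=> i s [vi [[_ h0 _] _ _ _]]; rewrite vi h0.
  - split=> //; split=> //= [k l|x y _ _ _ _|x y k l]; rewrite /upd /= ?out0 //.
    by rewrite ltn0 andbF.
  - move=> i s lt_i [vi inv].
    pose J j s := [/\ nmem s 3 1 0 = j, nmem s 3 0 0 = i & Inv i j s].
    apply: (runs_weaken (Q1 := J n)) => [||s' [vj' vi' [sin P1 P2 P3]]].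
    + apply: (runs_for (t := 1 + ((5 * n.+1 + 2) * n.+1 + 2))).
      * by move=> j s' [vj _ [[_ h0 _] _ _ _]]; rewrite vj h0.
      * by split.
      * move=> j s' lt_j [vj vi' inv'].
        apply: (runs_weaken (body_run _ _ _ lt_i lt_j vi' vj inv')) => //.
        by move=> s2 [vi2 vj2 inv2]; do 2!split=> //.
    + by [].
    + do 2!split=> //; split=> //= x y ltx lty tx ty lex.
      by apply: P2 => //; move: lex; lia.
move=> s [_ [_ P1 P2 P3]]; split=> // x y ltx lty tx ty.
by apply: P2; rewrite ?ltx.
Qed.

(** * From the memory contents to the metric space *)

Lemma init_nmem_T (R : realType) (n : nat) (delta : 'I_n -> 'I_n -> R)
    (T : {set 'I_n}) (eps : R) (x : 'I_n) :
  nmem (init_state delta T eps) 1 x 0 = (x \in T).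
Proof. by rewrite /= valK. Qed.

Lemma close_init (R : realType) (n : nat) (delta : 'I_n -> 'I_n -> R)
    (T : {set 'I_n}) (eps : R) (x y k l : 'I_n) :
  close (rmem (init_state delta T eps)) x y k l
    = (4 * (delta x k + delta y l) <= eps * delta x y).
Proof. by rewrite /close /= !valK; congr (_ <= _); ring. Qed.

Theorem theorem6 (R : realType) (d : R) :
  exists (C : R) (prog : cmd) (a b : nat),
    forall (n : nat) (delta : 'I_n -> 'I_n -> R) (T : {set 'I_n}) (eps : R),
      is_metric delta -> is_corr_dim delta d -> 0 < eps < 1 ->
      exists (t : nat) (s : state R),
        [/\ exec prog (init_state delta T eps) t s,
            (t <= a * n.+1 ^ b)%N,
            is_subset_spanner delta T eps (output_graph (n := n) s) &
            lightness_le delta T (output_graph (n := n) s)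
              (C * (1 + ln (eps^-1)) * (eps `^ (- (d / 2 + 3)) * Num.sqrt n%:R))].
Proof.
exists (768 * 68 `^ (d / 2)), gap_greedy, 16%N, 4%N.
move=> n delta T eps md [cd cd_min] eps01; have [d_ge0 d0 dC tri] := md.
(* On the empty space all ball sums vanish, so every real number is a bound and none is smallest. A
   point is needed as centre of the star. *)
have n_gt0 : (0 < n)%N.
  rewrite lt0n; apply/negP => /eqP n0; subst n.
  have cd' : corr_dim_bound delta (d - 1).
    by move=> N r _ _; rewrite !big1 ?mulr0 // => -[].
  by have := cd_min _ cd'; rewrite lerBrDr gerDl ler10.
have [||t [s [ex le_t [sel cov gap]]]] :=
    @gap_greedy_run R n (init_state delta T eps) erefl.
- by move=> [|?] [|?].
- move=> x y ltx lty.
  pose x' := Ordinal ltx; pose y' := Ordinal lty.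
  rewrite (close_init _ _ _ x' y' x' y') (d0 x' x').2 // (d0 y' y').2 //.
  by rewrite addr0 mulr0 mulr_ge0 //; case/andP: eps01 => /ltW.
pose P := [set e : 'I_n * 'I_n | nmem s 2 e.1 e.2 != 0%N].
exists t, s; split=> //.
- apply: (gap_cover_spanner (P := fun k l => (k, l) \in P)) => //.
  + split=> [x y|x]; rewrite /output_graph; last by rewrite eqxx.
    by rewrite eq_sym orbC.
  + move=> k l; rewrite inE => /eqP/[dup] /sel[_ _]; rewrite !init_nmem_T.
    move=> kT lT /eqP okl; split; try by apply/negPn/negP => /negPf h; rewrite h in kT lT.
    by rewrite /output_graph okl; case: eqP.
  + move=> x y xT yT.
    have [||k [l [okl]]] := cov x y (ltn_ord x) (ltn_ord y); rewrite ?init_nmem_T ?xT ?yT //.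
    have [ltk ltl _ _] := sel _ _ okl.
    rewrite (close_init _ _ _ x y (Ordinal ltk) (Ordinal ltl)) => ckl.
    by exists (Ordinal ltk), (Ordinal ltl); rewrite inE /=; split=> //; exact/eqP.
- have [V [M minM]] := min_steiner_tree_exists delta T (Ordinal n_gt0).
  exists V, M; split=> //; have [[[_ _ conM _] /fintype.subsetP TV] _] := minM.
  have W0 : 0 <= weight delta M.
    by rewrite divr_ge0 // sumr_ge0 // => x _; exact: sumr_ge0.
  apply: le_trans (lightness_constant d n eps01 W0); rewrite -[in (_ * n%:R)](card_ord n).
  apply: (gap_weight (T := T) (P := P)) => //.
  + by rewrite card_ord.
  + by move=> x y /TV xV /TV yV; exact: conM.
  + move=> [k l]; rewrite inE /= => /eqP /sel[_ _]; rewrite !init_nmem_T.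
    by case: (_ \in T); case: (_ \in T).
  + move=> [x y] [k l]; rewrite !inE /= => /eqP oxy /eqP okl neq.
    have neq' : (x : nat, y : nat) != (k : nat, l : nat) by exact: neq.
    have min_le u v : Num.min u v <= u /\ Num.min u v <= v :> R.
      by rewrite !ge_min !lexx orbT.
    have [m1 m2] := min_le (delta x y) (delta k l).
    have /andP[eps0 _] := eps01.
    (* Whichever test failed, its right-hand side is [eps] times the length of one of the pairs,
       which is at least the minimum. *)
    have [] := gap _ _ _ _ oxy okl neq'; rewrite close_init -ltNge mulrC.
      by apply: le_lt_trans; rewrite ler_pM2r.
    rewrite (dC k x) (dC l y).
    by apply: le_lt_trans; rewrite ler_pM2r.
  + by move=> x y; rewrite !inE => /andP[].
Qed.
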